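(* Let $F$ be a finite set of partial operations on $\{0,1\}$. Then $\varGamma_{\mathrm{SCB}}\neq\mathrm{Inv}(F)$, where $\varGamma_{\mathrm{SCB}}$ is the set of all safely componentwise bijunctive relations on $\{0,1\}$.
   Context: A relation $R\subseteq\{0,1\}^r$ is bijunctive if it is the set of satisfying assignments of a 2-CNF formula. The graph $G(R)$ has vertex set $R$, two tuples adjacent iff they differ in exactly one coordinate; $R$ is componentwise bijunctive if every connected component of $G(R)$ (as a relation) is bijunctive. For $0<k<r$, $R'(x_1,\dots,x_{r-k})=R(\xi_1,\dots,\xi_r)$ with every $\xi_j\in\{x_1,\dots,x_{r-k}\}$ is obtained by identification of variables. $R$ is safely componentwise bijunctive if $R$ and every relation obtained from it by identification of variables are componentwise bijunctive. A $k$-ary partial operation on $\{0,1\}$ is a map from a subset of $\{0,1\}^k$ to $\{0,1\}$, applied to tuples coordinatewise (defined iff every coordinate is defined); a relation is invariant under it if every defined result of applying it to tuples of the relation lies in the relation. $\mathrm{Inv}(F)$ is the set of all relations on $\{0,1\}$ (of any arity) invariant under every operation of $F$. *)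

(* Defs.v *)
From mathcomp Require Import all_boot.
From mathcomp Require Import boolp classical_sets functions cardinality.

Set Implicit Arguments.
Unset Strict Implicit.
Unset Printing Implicit Defensive.

Notation btuple r := {ffun 'I_r -> bool}.

Section Bijunctive.

Variable r : nat.
Implicit Types (R : {set btuple r}) (x y : btuple r).

(* The literal (i, b) stands for x_i if b = true, and for its negation if
   b = false. *)
Definition literal : Type := 'I_r * bool.
Definition clause : Type := seq literal.
Definition cnf : Type := seq clause.

Definition literal_sat x (l : literal) : bool := x l.1 == l.2.
Definition clause_sat x (c : clause) : bool := has (literal_sat x) c.
Definition cnf_sat x (phi : cnf) : bool := all (clause_sat x) phi.

Definition is_2cnf (phi : cnf) : bool := all (fun c : clause => size c <= 2) phi.

Definition bijunctive R : Prop :=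
  exists2 phi : cnf, is_2cnf phi & R = finset (fun x => cnf_sat x phi).

Definition adjacent R : rel (btuple r) :=
  fun x y => [&& x \in R, y \in R & #|[pred i | x i != y i]| == 1].

(* Intended for x \in R; it is then a subset of R, since connect is the
   reflexive-transitive closure. *)
Definition component R x : {set btuple r} := finset (connect (adjacent R) x).

Definition componentwise_bijunctive R : Prop :=
  forall x, x \in R -> bijunctive (component R x).

End Bijunctive.

(* The j-th variable of R is replaced by the variable of index xi j. *)
Definition identify (r s : nat) (xi : 'I_r -> 'I_s) (R : {set btuple r}) :
    {set btuple s} :=
  finset (fun x : btuple s => [ffun j => x (xi j)] \in R).

Definition safely_componentwise_bijunctive (r : nat) (R : {set btuple r}) : Prop :=
  componentwise_bijunctive R /\
  forall k : nat, 0 < k < r ->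
    forall xi : 'I_r -> 'I_(r - k), componentwise_bijunctive (identify xi R).

Record boolrel : Type := BoolRel {
  arity : nat;
  arity_gt0 : 0 < arity;
  tuples : {set btuple arity}
}.

(* None means that the operation is undefined at the given argument. *)
Record partial_op : Type := PartialOp {
  op_arity : nat;
  op_fun : {ffun btuple op_arity -> option bool}
}.

(* The equations on u say that f applied coordinatewise to the tuples t i is
   defined with result u. *)
Definition invariant_under (f : partial_op) (r : nat) (R : {set btuple r}) : Prop :=
  forall t : 'I_(op_arity f) -> btuple r, (forall i, t i \in R) ->
  forall u : btuple r,
    (forall j : 'I_r, op_fun f [ffun i => t i j] = Some (u j)) -> u \in R.

Definition InvRel (F : set partial_op) : set boolrel :=
  fun R => forall f, F f -> invariant_under f (tuples R).

Definition Gamma_SCB : set boolrel :=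
  fun R => safely_componentwise_bijunctive (tuples R).

(* Main.v *)
Require Import Defs.
From mathcomp Require Import all_boot.
From mathcomp Require Import boolp classical_sets functions cardinality.
From mathcomp Require Import zify.

Set Implicit Arguments.
Unset Strict Implicit.
Unset Printing Implicit Defensive.

(** If [Gamma_SCB] were [InvRel F] with all arities in [F] at most [N], then a
    relation of which any [N] tuples lie in a safely componentwise bijunctive
    subrelation would itself be safely componentwise bijunctive.  Let [R] be
    the path in the hypercube that starts at [0101...], flips the coordinates
    [0, 1, ..., n] in this order, and finally flips [0] again.  It is connected
    but not closed under majority, hence not componentwise bijunctive.  Removing
    one inner vertex leaves two geodesics, any subset of which is closed under
    majority.  No identification of variables can reconnect them: it would have
    to identify two consecutive coordinates, which carry different values just
    before the gap because the starting point alternates.  There are more inner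
    vertices than [N], so any [N] tuples of [R] miss one of them. *)

(** * Majority and bijunctive relations *)

Definition maj (r : nat) (x y z : btuple r) : btuple r :=
  [ffun i => if x i == y i then x i else z i].

Definition maj_closed (r : nat) (R : {set btuple r}) : Prop :=
  forall x y z, x \in R -> y \in R -> z \in R -> maj x y z \in R.

(** Of three tuples satisfying a two-literal clause, two satisfy the same literal, and the majority
    agrees with them there. *)
Lemma bijunctive_maj_closed (r : nat) (R : {set btuple r}) :
  bijunctive R -> maj_closed R.
Proof.
case=> phi phi2 ->; move=> x y z; rewrite !inE => /allP hx /allP hy /allP hz.
apply/allP => c c_phi; move: (hx c c_phi) (hy c c_phi) (hz c c_phi).
move/allP/(_ c c_phi): phi2; rewrite /clause_sat.
case: c {c_phi} => [|[i b] [|[j d] [|//]]] //= _;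
  rewrite /literal_sat /= !ffunE.
- by case: (x i) (y i) (z i) b => [] [] [] [].
- by case: (x i) (y i) (z i) b (x j) (y j) (z j) d
    => [] [] [] [] [] [] [] [].
Qed.

(* Baker-Pixley: [x] is in [R] once each of its projections to two coordinates
   is, since three extensions of [x] on [J] minus a point merge by majority. *)
Lemma maj_closed_extend (r : nat) (R : {set btuple r}) (x : btuple r) :
  maj_closed R ->
  (forall i j, exists2 y, y \in R & y i = x i /\ y j = x j) ->
  forall (a b : 'I_r) (s : seq 'I_r),
  exists2 y, y \in R & {in a :: b :: s, forall i, y i = x i}.
Proof.
move=> Rmaj R2 a b s; elim: s a b => [|c s IHs] a b.
  have [y yR [ya yb]] := R2 a b.
  by exists y => // i; rewrite !inE => /orP[] /eqP->.
have [u uR hu] := IHs a b; have [v vR hv] := IHs a c.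
have [w wR hw] := IHs b c.
exists (maj u v w); first exact: Rmaj.
move=> i; rewrite !inE ffunE.
have := hu i; have := hv i; have := hw i; rewrite !inE.
by case: eqP => _; case: eqP => _; case: eqP => _; case: (i \in s) => //=;
  do ?[move/(_ isT) => -> | move=> _]; rewrite ?eqxx //; case: eqP.
Qed.

(** The formula consists of all two-literal clauses valid on [R]: if no tuple of [R] agrees with [x]
    at both [i] and [j], the clause forbidding this pair of values is among them and fails at
    [x]. *)
Lemma maj_closed_bijunctive (r : nat) (R : {set btuple r}) (x0 : btuple r) :
  x0 \in R -> maj_closed R -> bijunctive R.
Proof.
move=> x0R Rmaj.
pose clauses : cnf r :=
  [seq [:: (p.1.1, p.2.1); (p.1.2, p.2.2)]
     | p : ('I_r * 'I_r) * (bool * bool)].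
exists [seq c <- clauses | [forall x in R, clause_sat x c]].
  by apply/allP => c; rewrite mem_filter => /andP[_ /mapP[p _ ->]].
apply/setP => x; rewrite inE; apply/idP/allP => [xR c|xsat].
  by rewrite mem_filter => /andP[/forall_inP/(_ x xR)].
have R2 i j : exists2 y, y \in R & y i = x i /\ y j = x j.
  have [/exists_inP[y yR /andP[/eqP yi /eqP yj]]|/exists_inPn none] :=
    boolP [exists y in R, (y i == x i) && (y j == x j)]; first by exists y.
  have: clause_sat x [:: (i, ~~ x i); (j, ~~ x j)].
    apply: xsat; rewrite mem_filter; apply/andP; split.
      apply/forall_inP => y /none.
      rewrite /clause_sat /= /literal_sat /=.
      by case: (x i) (y i) (x j) (y j) => [] [] [] [].
    by apply/mapP; exists ((i, j), (~~ x i, ~~ x j)); rewrite ?mem_enum.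
  by rewrite /clause_sat /= /literal_sat /=; case: (x i) (x j) => [] [].
case: r => [|r] in R x0 x0R Rmaj clauses x xsat R2 *.
  by suff -> : x = x0; [|apply/ffunP; case].
have [y yR yx] := maj_closed_extend Rmaj R2 ord0 ord0 (enum 'I_r.+1).
suff -> : x = y by [].
by apply/ffunP => i; rewrite yx // !inE mem_enum !orbT.
Qed.

(** * Majority on connected components *)

Lemma adjacent_sym (r : nat) (R : {set btuple r}) : symmetric (adjacent R).
Proof.
move=> x y; rewrite /adjacent andbCA; congr [&& _, _ & _ == 1].
by apply: eq_card => i; rewrite !inE eq_sym.
Qed.

Lemma adjacent_maj (r : nat) (R A : {set btuple r}) (x x' y z : btuple r) :
  A \subset R -> maj_closed A -> adjacent R x x' ->
  x \in A -> x' \in A -> y \in A -> z \in A ->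
  connect (adjacent R) (maj x y z) (maj x' y z).
Proof.
move=> AR Amaj /and3P[_ _ /eqP xx'] xA x'A yA zA.
have [->|neq] := eqVneq (maj x y z) (maj x' y z); first exact: connect0.
apply: connect1; rewrite /adjacent !(fintype.subsetP AR) ?Amaj //= eqn_leq -{1}xx'.
apply/andP; split.
  apply/subset_leq_card/fintype.subsetP => i; rewrite !inE !ffunE.
  by apply: contra => /eqP->.
rewrite lt0n; apply: contra_neq neq => /card0_eq h; apply/ffunP => i.
by have /negbFE/eqP := h i.
Qed.

(** Majority with [v] and [w] turns a walk from [v] to [u] into a walk, possibly with pauses, from
    [v] to [maj u v w]. The closure properties of [A] keep it inside [R]. *)
Lemma component_maj_closed (r : nat) (R A : {set btuple r}) (x : btuple r) :
  A \subset R -> maj_closed A -> x \in A ->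
  (forall y z, adjacent R y z -> y \in A -> z \in A) ->
  maj_closed (component R x).
Proof.
move=> AR Amaj xA Aadj.
have Acon y z : connect (adjacent R) y z -> y \in A -> z \in A.
  case/connectP=> p + ->; elim: p y => //= w p IHp y /andP[yw wp] yA.
  by apply: IHp wp _; apply: Aadj yw yA.
move=> u v w; rewrite !inE => xu xv xw.
have vA := Acon _ _ xv xA; have wA := Acon _ _ xw xA.
have majv : maj v v w = v by apply/ffunP => i; rewrite ffunE eqxx.
have csym := sym_connect_sym (@adjacent_sym _ R).
have vu : connect (adjacent R) v u by apply: connect_trans xu; rewrite csym.
apply: connect_trans xv _; rewrite -{1}majv.
case/connectP: vu=> p + ->; elim/last_ind: p => [|p y IHp]; first by rewrite connect0.
rewrite rcons_path last_rcons => /andP[vp py].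
apply: connect_trans (IHp vp) _.
have lA : last v p \in A by apply: Acon vA; apply/connectP; exists p.
by apply: (adjacent_maj AR) => //; apply: Aadj py lA.
Qed.

(** * The path in the hypercube *)

(** The three terms are the alternating start, the flips made before time [t], and the second flip
    of coordinate 0, which affects only the last vertex [n.+2]. *)
Definition snake (n t : nat) : btuple n.+1 :=
  [ffun i : 'I_n.+1 => odd i (+) (i < t) (+) ((i == 0 :> nat) && (t == n.+2))].

Definition snake_set (n : nat) : {set btuple n.+1} :=
  [set x | [exists t : 'I_n.+3, x == snake n t]]%SET.

Lemma snake_setP (n : nat) (x : btuple n.+1) :
  reflect (exists2 t, t < n.+3 & x = snake n t) (x \in snake_set n).
Proof.
rewrite inE; apply: (iffP existsP) => [[t /eqP->]|[t tn ->]]; first by exists t.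
by exists (Ordinal tn).
Qed.

Lemma snake_eqE (n s t : nat) (i : 'I_n.+1) : s < n.+3 -> t < n.+3 ->
  (snake n s i == snake n t i) =
  if i == 0 :> nat then (0 < s < n.+2) == (0 < t < n.+2) else (i < s) == (i < t).
Proof.
move=> sn tn; rewrite !ffunE; case: ifP => [/eqP->|_] /=.
  have -> : (s == n.+2) = ~~ (s < n.+2) by lia.
  have -> : (t == n.+2) = ~~ (t < n.+2) by lia.
  by case: s t {sn tn} => [|s] [|t] //=; do 2?case: (_ < _).
by rewrite !addbF; case: odd; case: (_ < s); case: (_ < t).
Qed.

Lemma snake_unflipped (n t : nat) (i : 'I_n.+1) : 0 < i -> t <= i -> snake n t i = odd i.
Proof. by case: i => -[//|i] lt_in _ ti; rewrite ffunE ltnNge ti !addbF. Qed.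

(** At vertex [p], coordinate [p.-1] has been flipped and [p] has not; as both are nonzero, this
    determines the time. *)
Lemma snake_neq (n p t : nat) :
  1 < p <= n -> t < n.+3 -> t != p -> snake n t != snake n p.
Proof.
move=> hp tn; apply: contra_neq => e.
have pn : p < n.+3 by lia.
have := snake_eqE (inord p) tn pn; have := snake_eqE (inord p.-1) tn pn.
rewrite e !eqxx !inordK; [|lia..].
have -> : (p == 0) = false by lia.
have -> : (p.-1 == 0) = false by lia.
by move=> /esym/eqP h /esym/eqP h'; lia.
Qed.

Lemma snake_adjacent (n t : nat) :
  t < n.+2 -> adjacent (snake_set n) (snake n t) (snake n t.+1).
Proof.
move=> tn; apply/and3P; split.
- by apply/snake_setP; exists t => //; lia.
- by apply/snake_setP; exists t.+1.
apply/eqP; rewrite -(card1 (inord (if t == n.+1 then 0 else t) : 'I_n.+1)).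
apply: eq_card => i; rewrite !inE !ffunE -val_eqE /= inordK; last by case: ifP; lia.
have := ltn_ord i; move: (nat_of_ord i) => {}i lt_in.
have -> : (t == n.+2) = false by lia.
rewrite eqSS ltnS andbF addbF.
have [->|ne_t] := eqVneq t n.+1.
  by rewrite lt_in ltnW //; case: (i == 0); case: (odd i).
by rewrite andbF addbF (leq_eqVlt i); case: ltngtP => //; case: (odd i).
Qed.

Lemma snake_set_not_cb (n : nat) : 2 <= n -> ~ componentwise_bijunctive (snake_set n).
Proof.
move=> n2 cb.
have s0 : snake n 0 \in snake_set n by apply/snake_setP; exists 0.
have con t : t < n.+3 -> snake n t \in component (snake_set n) (snake n 0).
  elim: t => [|t IHt] tn; first by rewrite inE connect0.
  have := IHt (ltnW tn); rewrite !inE => h; apply: connect_trans h _.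
  exact/connect1/snake_adjacent.
have sub x : x \in component (snake_set n) (snake n 0) -> x \in snake_set n.
  rewrite inE => /connectP[p + ->]; case/lastP: p => // p y.
  by rewrite rcons_path last_rcons => /andP[_ /and3P[]].
(* The two ends agree only at coordinate 0, so their majority with vertex 2 is vertex 2 with
   coordinate 0 reset. Coordinates 1 and 2 force [t = 2], where coordinate 0 is flipped. *)
have /sub/snake_setP[t tn] := bijunctive_maj_closed (cb _ s0)
  (con 0 isT) (con n.+2 (ltnSn _)) (con 2 (ltnW (ltnW n2))).
move/ffunP => e.
have := e (inord 0); have := e (inord 1); have := e (inord 2).
rewrite !ffunE !inordK //; try lia.
rewrite eqxx; case: (n) n2 => [|[|m]] //= _.
by case: (t) => [|[|[|k]]].
Qed.

(** A stretch that misses an end of the path flips no coordinate twice. *)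
Lemma snake_between (n s t u i : nat) (i_n : i < n.+1) :
  s <= t <= u -> u < n.+3 -> (0 < s) || (u < n.+2) ->
  (snake n t (Ordinal i_n) == snake n s (Ordinal i_n))
  || (snake n t (Ordinal i_n) == snake n u (Ordinal i_n)).
Proof.
move=> stu un su; rewrite !snake_eqE /=; try lia.
by case: eqP => ?; lia.
Qed.

(** The majority is the vertex of median time. *)
Lemma maj_snake (n lo hi a b c : nat) :
  hi < n.+3 -> (0 < lo) || (hi < n.+2) ->
  lo <= a <= hi -> lo <= b <= hi -> lo <= c <= hi ->
  exists2 t, lo <= t <= hi & maj (snake n a) (snake n b) (snake n c) = snake n t.
Proof.
move=> hin lohi ha hb hc.
have mid s t u : s <= t <= u -> lo <= s <= hi -> lo <= u <= hi -> forall i,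
    (snake n t i == snake n s i) || (snake n t i == snake n u i).
  by move=> stu hs hu [i i_n]; apply: snake_between; lia.
case: (leqP a b) => ab; case: (leqP b c) => bc; case: (leqP a c) => ac; try lia.
- exists b => //; apply/ffunP => i; rewrite ffunE.
  have := mid a b c ltac:(lia) ha hc i.
  by case: (snake n a i) (snake n b i) (snake n c i) => [] [] [].
- exists c => //; apply/ffunP => i; rewrite ffunE.
  have := mid a c b ltac:(lia) ha hb i.
  by case: (snake n a i) (snake n b i) (snake n c i) => [] [] [].
- exists a => //; apply/ffunP => i; rewrite ffunE.
  have := mid c a b ltac:(lia) hc hb i.
  by case: (snake n a i) (snake n b i) (snake n c i) => [] [] [].
- exists a => //; apply/ffunP => i; rewrite ffunE.
  have := mid b a c ltac:(lia) hb hc i.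
  by case: (snake n a i) (snake n b i) (snake n c i) => [] [] [].
- exists c => //; apply/ffunP => i; rewrite ffunE.
  have := mid b c a ltac:(lia) hb ha i.
  by case: (snake n a i) (snake n b i) (snake n c i) => [] [] [].
- exists b => //; apply/ffunP => i; rewrite ffunE.
  have := mid c b a ltac:(lia) hc ha i.
  by case: (snake n a i) (snake n b i) (snake n c i) => [] [] [].
Qed.

(** * Identification of variables in the path with a gap *)

Definition pullback (r s : nat) (xi : 'I_r -> 'I_s) (x : btuple s) : btuple r :=
  [ffun j => x (xi j)].

Lemma pullback_maj (r s : nat) (xi : 'I_r -> 'I_s) (x y z : btuple s) :
  pullback xi (maj x y z) = maj (pullback xi x) (pullback xi y) (pullback xi z).
Proof. by apply/ffunP => i; rewrite !ffunE. Qed.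

(* Coordinates [p.-1] and [p] change between the two sides of the gap, so both
   are mapped to the single coordinate in which [x] and [y] differ; but
   [snake n t] has different values there. *)
Lemma gap_not_adjacent (n p t u s : nat) (xi : 'I_n.+1 -> 'I_s)
    (R : {set btuple s}) (x y : btuple s) :
  1 < p <= n -> t < p -> p < u < n.+3 ->
  pullback xi x = snake n t -> pullback xi y = snake n u -> ~~ adjacent R x y.
Proof.
move=> hp tp pu /ffunP ex /ffunP ey; apply/and3P => -[_ _ /eqP card1D].
have hi : p.-1 < n.+1 by lia.
have hj : p < n.+1 by lia.
pose i := Ordinal hi; pose j := Ordinal hj.
have xy k : snake n t k != snake n u k -> x (xi k) != y (xi k).
  by rewrite -ex -ey !ffunE.
have xy_i : x (xi i) != y (xi i).
  by apply: xy; rewrite snake_eqE /=; [case: eqP => ?; lia|lia..].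
have xy_j : x (xi j) != y (xi j).
  by apply: xy; rewrite snake_eqE /=; [case: eqP => ?; lia|lia..].
have /card_le1_eqP e : #|[pred i | x i != y i]| <= 1 by rewrite card1D.
have eij : xi i = xi j by apply: e.
have := ex i; have := ex j; rewrite ![pullback _ _ _]ffunE eij => ->.
rewrite !snake_unflipped /=; [|lia..].
by case: (p) hp => [|[|q]] //= _; case: (odd q).
Qed.

(** Each side of the gap pulls back to a set [A lo hi] closed under majority, which no edge
    leaves. *)
Lemma identify_snake_gap_cb (n p s : nat) (xi : 'I_n.+1 -> 'I_s) :
  1 < p <= n ->
  componentwise_bijunctive (identify xi (snake_set n :\ snake n p)).
Proof.
move=> hp; set Q := identify _ _.
have QP x : reflect (exists2 t, (t < n.+3) && (t != p) & pullback xi x = snake n t)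
                    (x \in Q).
  rewrite inE in_setD1; apply: (iffP andP) => [[neq /snake_setP[t tn e]]|].
    by exists t => //; rewrite tn; apply: contra_neq neq => <-.
  move=> [t /andP[tn tp] e]; rewrite [finfun _]e snake_neq //.
  by split=> //; apply/snake_setP; exists t.
pose A lo hi := [set y | [exists t : 'I_n.+3,
  (lo <= t <= hi) && (pullback xi y == snake n t)]]%SET.
have AP lo hi y : hi < n.+3 -> reflect
    (exists2 t, lo <= t <= hi & pullback xi y = snake n t) (y \in A lo hi).
  move=> hin; rewrite inE; apply: (iffP existsP) => [[t /andP[ht /eqP e]]|].
    by exists t.
  move=> [t ht e]; have tn : t < n.+3 by lia.
  by exists (Ordinal tn); rewrite /= ht e eqxx.
move=> x xQ.
have [lo [hi [hin side xA]]] : exists lo hi, [/\ hi < n.+3,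
    (lo == 0) && (hi == p.-1) || (lo == p.+1) && (hi == n.+2) & x \in A lo hi].
  have /QP[t ht e] := xQ.
  have [tp|tp] := leqP t p.
    by exists 0, p.-1; split; [lia|lia|apply/AP; [lia|exists t => //; lia]].
  by exists p.+1, n.+2; split; [lia|lia|apply/AP; [lia|exists t => //; lia]].
apply: (@maj_closed_bijunctive _ _ x); first by rewrite inE connect0.
apply: (@component_maj_closed _ _ (A lo hi)) => //.
- apply/fintype.subsetP => y /(AP _ _ _ hin)[t ht e].
  by apply/QP; exists t => //; lia.
- move=> u v w /(AP _ _ _ hin)[a ha ea] /(AP _ _ _ hin)[b hb eb].
  move=> /(AP _ _ _ hin)[c hc ec]; apply/AP => //.
  by rewrite pullback_maj ea eb ec; apply: maj_snake => //; lia.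
move=> y z yz /(AP _ _ _ hin)[t ht ey]; apply/AP => //.
have /and3P[_ /QP[u hu ez] _] := yz; exists u => //.
have [tp|tp] := ltnP t p; have [up|up] := ltnP u p; try lia.
  have pu : p < u < n.+3 by lia.
  by have := gap_not_adjacent Q hp tp pu ey ez; rewrite yz.
have pt : p < t < n.+3 by lia.
by have := gap_not_adjacent Q hp up pt ez ey; rewrite adjacent_sym yz.
Qed.

Lemma snake_gap_scb (n p : nat) : 1 < p <= n ->
  safely_componentwise_bijunctive (snake_set n :\ snake n p).
Proof.
move=> hp; split=> [|k _ xi]; last exact: identify_snake_gap_cb.
have := @identify_snake_gap_cb n p _ id hp; congr componentwise_bijunctive.
apply/setP => x; rewrite inE; suff -> : [ffun j => x (id j)] = x by [].
by apply/ffunP => i; rewrite ffunE.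
Qed.

(** * Finitely many operations *)

Lemma finite_op_arity_bounded (F : set partial_op) :
  finite_set F -> exists N, forall f, F f -> op_arity f <= N.
Proof.
move=> /(finite_image (@op_arity))/finite_seqP[s Fs].
exists (\max_(i <- s) i) => f Ff; apply: leq_bigmax_seq => //.
have : [set` s]%classic (op_arity f) by rewrite -Fs; exists f.
by [].
Qed.

(** The [N.+1] vertices from 2 to [N.+2] are distinct, so at most [N] tuples cannot cover them. *)
Lemma snake_avoid (N k : nat) (t : 'I_k -> btuple N.+3) : k <= N ->
  exists2 p, 1 < p <= N.+2 & forall i, t i != snake N.+2 p.
Proof.
move=> kN; pose g (q : 'I_N.+1) := snake N.+2 q.+2.
have g_inj : injective g.
  move=> q q' e; apply/val_inj/eqP; apply: contraT => neq.
  have [lq lq'] := (ltn_ord q, ltn_ord q').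
  by have := @snake_neq N.+2 q'.+2 q.+2 ltac:(lia) ltac:(lia) neq; rewrite -/(g q) e eqxx.
have [/forallP all_hit|/forallPn[q miss]] := boolP [forall q, g q \in codom t].
  have : #|codom g| <= #|codom t|.
    by apply/subset_leq_card/fintype.subsetP => _ /codomP[q ->].
  rewrite card_codom // card_ord => /leq_trans/(_ (leq_image_card _ _)).
  by rewrite card_ord; lia.
exists q.+2 => [|i]; first by have := ltn_ord q; lia.
by apply: contraNneq miss => e; rewrite /g -e codom_f.
Qed.

Theorem theorem62 (F : set partial_op) (finF : finite_set F) :
  Gamma_SCB <> InvRel F.
Proof.
move=> eqF; have [N arN] := finite_op_arity_bounded finF.
pose snakeR := @BoolRel N.+3 isT (snake_set N.+2).
have : InvRel F snakeR.
  move=> f Ff t tR u fu.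
  have [p hp miss] := snake_avoid t (arN f Ff).
  have : Gamma_SCB (@BoolRel N.+3 isT (snake_set N.+2 :\ snake N.+2 p)).
    exact: snake_gap_scb.
  rewrite eqF => /(_ f Ff t) /= gapF.
  (* The arguments of [f] avoid vertex [p], so they already lie in the path with the gap, which [f]
     preserves. *)
  have : u \in snake_set N.+2 :\ snake N.+2 p.
    by apply: gapF fu => i; rewrite in_setD1 miss tR.
  by rewrite in_setD1 => /andP[].
by rewrite -eqF => -[cb _]; apply: snake_set_not_cb cb.
Qed.
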